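(* Let $d\ge1$. Every convex CPWL function $f\colon\mathbb{R}^d\to\mathbb{R}$ with $k$ affine components (equivalently, since $f$ is convex, with $q=k$ pieces) can be represented by a ReLU neural network with $\lceil\log_2(d+1)\rceil+\lceil\log_2 r\rceil$ hidden layers and overall size $\mathcal{O}(rs^{d+1})$, for any choice of positive integers $r$ and $s$ with $rs\ge k$. Here the constant implied by $\mathcal{O}$ may depend on $d$ but not on $f$, $k$, $r$, $s$.
   Context: A CPWL function $f\colon\mathbb{R}^d\to\mathbb{R}$ is a continuous function for which there is a complete polyhedral complex (finitely many polyhedra covering $\mathbb{R}^d$) on each member of which $f$ is affine; its affine components are the distinct affine functions agreeing with $f$ on some full-dimensional polyhedron of such a complex. A convex CPWL function with $k$ affine components is $f(x)=\max_{i\in[k]}(\langle a_i,x\rangle+b_i)$. The number of pieces is the smallest possible number of full-dimensional polyhedra in a compatible complex. A ReLU neural network with $\ell\ge0$ hidden layers is a sequence of affine maps $T_i\colon\mathbb{R}^{n_{i-1}}\to\mathbb{R}^{n_i}$, $i=1,\dots,\ell+1$, with $n_0=d$, $n_{\ell+1}=1$. It represents (computes) the function $T_{\ell+1}\circ\sigma\circ T_\ell\circ\sigma\circ\dots\circ\sigma\circ T_1$, where $\sigma$ applies $x\mapsto\max\{x,0\}$ in each component. Its size is $\sum_{i=1}^{\ell}n_i$. *)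

(* Defs.v *)
From HB Require Import structures.
From mathcomp Require Import all_boot all_order all_algebra.
From mathcomp Require Import all_classical all_reals all_analysis.

Set Implicit Arguments.
Unset Strict Implicit.
Unset Printing Implicit Defensive.

Import Order.TTheory GRing.Theory Num.Theory.
Import numFieldNormedType.Exports.

Local Open Scope classical_set_scope.
Local Open Scope ring_scope.

(* R^n is modelled by column vectors 'cV[R]_n. *)

Definition dotv (R : realType) (n : nat) (a x : 'cV[R]_n) : R :=
  \sum_(i < n) a i 0 * x i 0.

Definition affine_fun (R : realType) (n : nat) (g : 'cV[R]_n -> R) : Prop :=
  exists (a : 'cV[R]_n) (b : R), forall x, g x = dotv a x + b.

Definition polyhedron (R : realType) (n : nat) (P : set 'cV[R]_n) : Prop :=
  exists (m : nat) (A : 'M[R]_(m, n)) (b : 'cV[R]_m),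
    P = [set x | forall i : 'I_m, (A *m x) i 0 <= b i 0].

(* The valid inequalities <0, x> <= 0 and <0, x> <= 1 make P itself and the
   empty set faces of P. *)
Definition face (R : realType) (n : nat) (P F : set 'cV[R]_n) : Prop :=
  exists (c : 'cV[R]_n) (beta : R),
    (forall x, P x -> dotv c x <= beta) /\
    F = P `&` [set x | dotv c x = beta].

Definition affine_hull (R : realType) (n : nat) (P : set 'cV[R]_n) :
    set 'cV[R]_n :=
  [set x | exists (m : nat) (w : 'I_m -> R) (p : 'I_m -> 'cV[R]_n),
     [/\ forall i, P (p i), \sum_(i < m) w i = 1
       & x = \sum_(i < m) w i *: p i]].

Definition full_dimensional (R : realType) (n : nat) (P : set 'cV[R]_n) :
    Prop :=
  affine_hull P = setT.

Definition polyhedral_complex (R : realType) (n : nat)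
    (C : set (set 'cV[R]_n)) : Prop :=
  [/\ finite_set C,
      forall P, C P -> polyhedron P,
      forall P F, C P -> face P F -> C F
    & forall P Q, C P -> C Q -> face P (P `&` Q) /\ face Q (P `&` Q)].

Definition complete_complex (R : realType) (n : nat)
    (C : set (set 'cV[R]_n)) : Prop :=
  polyhedral_complex C /\ \bigcup_(P in C) P = setT.

Definition agree_on (R : realType) (n : nat) (P : set 'cV[R]_n)
    (f g : 'cV[R]_n -> R) : Prop :=
  forall x, P x -> f x = g x.

Definition compatible (R : realType) (n : nat) (f : 'cV[R]_n -> R)
    (C : set (set 'cV[R]_n)) : Prop :=
  complete_complex C /\
  forall P, C P -> exists g, affine_fun g /\ agree_on P f g.

Definition cpwl (R : realType) (n : nat) (f : 'cV[R]_n -> R) : Prop :=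
  continuous f /\ exists C, compatible f C.

Definition affine_component (R : realType) (n : nat)
    (f g : 'cV[R]_n -> R) : Prop :=
  affine_fun g /\
  exists C P, [/\ compatible f C, C P, full_dimensional P & agree_on P f g].

Definition has_components (R : realType) (n : nat) (f : 'cV[R]_n -> R)
    (k : nat) : Prop :=
  ([set g | affine_component f g] #= `I_k)%card.

Definition full_cells (R : realType) (n : nat) (C : set (set 'cV[R]_n)) :
    set (set 'cV[R]_n) :=
  [set P | C P /\ full_dimensional P].

Definition has_pieces (R : realType) (n : nat) (f : 'cV[R]_n -> R)
    (q : nat) : Prop :=
  (exists C, compatible f C /\ (full_cells C #= `I_q)%card) /\
  (forall C m, compatible f C -> (full_cells C #= `I_m)%card -> (q <= m)%N).

(* [relu_net R n l]: networks with input dimension n, l hidden layers and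
   output dimension 1; each constructor carries one affine map x |-> A x + b,
   and [Hidden] is followed by the activation. *)
Inductive relu_net (R : realType) : nat -> nat -> Type :=
| Output (n : nat) (A : 'M[R]_(1, n)) (b : 'cV[R]_1) : relu_net R n 0
| Hidden (n m l : nat) (A : 'M[R]_(m, n)) (b : 'cV[R]_m)
    (N : relu_net R m l) : relu_net R n l.+1.

Definition relu (R : realType) (n : nat) (x : 'cV[R]_n) : 'cV[R]_n :=
  map_mx (fun t : R => Num.max t 0) x.

Fixpoint net_eval (R : realType) (n l : nat) (N : relu_net R n l) :
    'cV[R]_n -> 'cV[R]_1 :=
  match N in relu_net _ n l return 'cV[R]_n -> 'cV[R]_1 with
  | Output _ A b => fun x => A *m x + b
  | Hidden _ _ _ A b N' => fun x => net_eval N' (relu (A *m x + b))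
  end.

Fixpoint net_size (R : realType) (n l : nat) (N : relu_net R n l) : nat :=
  match N with
  | Output _ _ _ => 0
  | Hidden _ m _ _ _ N' => m + net_size N'
  end.

Definition represents (R : realType) (n l : nat) (N : relu_net R n l)
    (f : 'cV[R]_n -> R) : Prop :=
  forall x, f x = net_eval N x 0 0.

(* Main.v *)
Require Import Defs.
From mathcomp Require Import all_boot all_order all_algebra.
From mathcomp Require Import all_classical all_reals all_analysis.
From mathcomp Require Import ring lra zify.

(** Why the theorem holds.

    Two facts about a convex CPWL function [f] reduce everything to maxima of
    affine functions.  A cell of full dimension has a point [p] at which all its
    non-trivial inequalities are strict; from [p] one can move a little towards
    any [y] without leaving the cell, and convexity along that segment forces
    the affine function of the cell to lie below [f] at [y] ([component_le]).
    And the full-dimensional cells already cover the space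
    ([full_cells_cover]).  Hence [f] is the pointwise maximum of its
    components ([components_max]).

    Components and pieces.  Every component is carried by some full cell of
    every compatible complex ([component_on_cell]), and a full cell carries only
    one affine function, so a complex has at least as many full cells as there
    are components.  Equality is attained by the complex whose cells are the
    sets where a prescribed nonempty set of components attains the maximum,
    together with the empty set: its full-dimensional cells are those of a single
    component ([active_complex_compatible], [active_complex_full_cells]).

    The network.  Any family of more than [d + 1] affine functions on a
    [d]-dimensional space has an affine dependence.  Splitting the family by the
    sign of the coefficients yields a nonempty part [N] such that at every
    point some member of [N] is dominated by a member of the rest
    ([affine_radon]).  So the alternating sum, over the subsets [A] of [N], of
    the maximum over the rest together with [A] vanishes
    ([setmax_incl_excl]), and it expresses the maximum over the whole family as
    a combination of maxima over proper subfamilies.  Iterating, a maximum of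
    [s] affine functions is a linear combination of the [s ^ (d + 1)] maxima
    over tuples of length [d + 1] ([setmax_comb]).  A maximum of [n] numbers is
    computed by a balanced tree of depth [up_log 2 n] and linear size
    ([max_net]).  Distributing the components over [r] groups of at most [s],
    the network evaluates all tuples of all groups in parallel with trees of
    depth [up_log 2 (d + 1)], forms the [r] linear combinations inside the
    next affine map, and takes the maximum of the groups by one more tree of
    depth [up_log 2 r] ([max_affine_net]). *)

Set Implicit Arguments.
Unset Strict Implicit.
Unset Printing Implicit Defensive.

Import Order.TTheory GRing.Theory Num.Theory.
Import numFieldNormedType.Exports.

Local Open Scope classical_set_scope.
Local Open Scope ring_scope.

(** * Maxima of families *)

Definition is_max (R : realType) (I : Type) (v : I -> R) (m : R) : Prop :=
  (forall i, v i <= m) /\ exists i, m = v i.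

Lemma is_max_uniq (R : realType) (I : Type) (v : I -> R) (m m' : R) :
  is_max v m -> is_max v m' -> m = m'.
Proof.
move=> [um [i mE]] [um' [j m'E]]; apply/eqP; rewrite eq_le.
by rewrite {1}mE um' m'E um.
Qed.

Lemma is_max_surj (R : realType) (I J : Type) (h : J -> I) (v : I -> R) (m : R) :
  (forall i, exists j, h j = i) -> is_max (v \o h) m <-> is_max v m.
Proof.
move=> hS; split=> -[um [i mE]]; split.
- by move=> k; have [j <-] := hS k; apply: um.
- by exists (h i).
- by move=> j; apply: um.
- by have [j hj] := hS i; exists j; rewrite /= hj.
Qed.

(** * Networks computing maxima *)

Section Networks.
Variable R : realType.
Implicit Types n m l : nat.

(** Dependent inversion: the depth index of a network determines its
    constructor. *)
Lemma net_inv n l (N : relu_net R n l) :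
  match l return relu_net R n l -> Prop with
  | 0 => fun N => exists A b, N = Output A b
  | l'.+1 => fun N => exists m (A : 'M[R]_(m, n)) b (N' : relu_net R m l'),
      N = Hidden A b N'
  end N.
Proof.
case: n l / N => [n A b|n m l A b N]; first by exists A, b.
by exists m, A, b, N.
Qed.

(** An affine map in front of a network is absorbed by its first affine map,
    which costs neither a layer nor a neuron. *)
Lemma net_precomp n n' l (N : relu_net R n l) (A : 'M[R]_(n, n')) (b : 'cV[R]_n) :
  exists N' : relu_net R n' l, net_size N' = net_size N /\
    forall x, net_eval N' x = net_eval N (A *m x + b).
Proof.
case: n l / N A b => [n A0 b0|n m l A0 b0 N] A b.
  exists (Output (A0 *m A) (A0 *m b + b0)); split=> // x /=.
  by rewrite mulmxDr mulmxA addrA.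
exists (Hidden (A0 *m A) (A0 *m b + b0) N); split=> // x /=.
by rewrite mulmxDr mulmxA addrA.
Qed.

(** Parallel evaluation of [m] networks of equal depth followed by a network
    on their outputs: sizes add up because the output maps of the [N i] merge
    with the first affine map of [T].  Induction on the depth stacks the first
    layers of the [N i] and lets each remaining network read its own block of
    the stack. *)
Lemma net_compose l : forall n m l' (N : 'I_m -> relu_net R n l)
    (T : relu_net R m l'),
  exists M : relu_net R n (l + l'),
    net_size M = (\sum_i net_size (N i) + net_size T)%N /\
    forall x, net_eval M x = net_eval T (\col_i net_eval (N i) x 0 0).
Proof.
elim: l => [|l IHl] n m l' N T.
  have /choice[A /choice[b NE]] := fun i => net_inv (N i).
  have [M [sM eM]] :=
    net_precomp T (\matrix_(i, j) A i 0 j) (\col_i b i 0 0).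
  exists M; split=> [|x].
    by rewrite sM big1 // => i _; rewrite NE.
  rewrite eM; congr net_eval; apply/colP => i; rewrite !mxE NE /= !mxE.
  by congr (_ + _); apply: eq_bigr => j _; rewrite !mxE.
(* The widths of the first layers differ, so the layers are chosen as
   dependent triples. *)
have /choice[L NE] : forall i, exists L : {p : nat &
    ('M[R]_(p, n) * 'cV[R]_p * relu_net R p l)%type},
    N i = Hidden (projT2 L).1.1 (projT2 L).1.2 (projT2 L).2.
  move=> i; have [p [A [b [N' ->]]]] := net_inv (N i).
  by exists (existT _ p (A, b, N')).
pose p i := projT1 (L i); pose A i : 'M[R]_(p i, n) := (projT2 (L i)).1.1.
pose b i : 'cV[R]_(p i) := (projT2 (L i)).1.2.
pose N' i : relu_net R (p i) l := (projT2 (L i)).2.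
have {}NE i : N i = Hidden (A i) (b i) (N' i) := NE i.
have /choice[N2 N2P] := fun i =>
  net_precomp (N' i) (rowsub (tagnat.Rank (p_ := p) i) 1%:M) 0.
have [M [sM eM]] := IHl _ _ _ N2 T.
exists (Hidden (\mxcol_i A i) (\mxcol_i b i) M); split=> [|x] /=.
  rewrite sM addnA -big_split /=; congr (_ + _)%N.
  by apply: eq_bigr => i _; rewrite NE /= (N2P i).1.
rewrite eM; congr net_eval; apply/colP => i; rewrite !mxE NE /= (N2P i).2.
congr (net_eval _ _ _ _); rewrite addr0 -rowsubE.
rewrite -[in RHS](mxcolK A i) -[in RHS](mxcolK b i) /submxcol.
rewrite mul_rowsub_mx.
by apply/matrixP => j k; rewrite !mxE.
Qed.

(** [max a b] is the combination [relu (a - b) + relu b - relu (- b)]. *)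
Lemma pair_max_net n (i j : 'I_n) :
  exists N : relu_net R n 1, net_size N = 3%N /\
    forall x, net_eval N x 0 0 = Num.max (x i 0) (x j 0).
Proof.
pose e k : 'rV[R]_n := delta_mx 0 k.
pose A : 'M[R]_(3, n) := \matrix_(k < 3) nth 0 [:: e i - e j; e j; - e j] k.
pose C : 'M[R]_(1, 3) := \row_(k < 3) nth 0 [:: 1; 1; -1] k.
exists (Hidden A 0 (Output C 0)); split=> // x /=.
have AE (k : 'I_3) : (A *m x) k 0 =
    (nth 0 [:: e i - e j; e j; - e j] k *m x) 0 0.
  by rewrite -(rowK (fun k : 'I_3 => nth 0 [:: e i - e j; e j; - e j] k) k)
    -row_mul [in RHS]mxE.
have eE k : (e k *m x) 0 0 = x k 0 by rewrite -rowE mxE.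
rewrite !addr0 mxE !big_ord_recl big_ord0.
have rE k : relu (A *m x) k 0 = Num.max ((A *m x) k 0) 0 by rewrite mxE.
have CE k : C 0 k = nth 0 [:: 1; 1; -1] k by rewrite mxE.
rewrite !rE !AE !CE /= mulmxBl mulNmx.
have sE (u v : 'cV[R]_1) : (u - v) 0 0 = u 0 0 - v 0 0 by rewrite !mxE.
have nE (u : 'cV[R]_1) : (- u) 0 0 = - u 0 0 by rewrite mxE.
rewrite sE nE !eE; move: (x i 0) (x j 0) => a b.
by case: (leP (a - b) 0); case: (leP b 0); case: (leP (- b) 0);
  case: (leP a b); lra.
Qed.

(** A knockout tournament: entry [i] of the first half meets entry [i] of the
    second half.  With three neurons per match the size is exactly
    [3 * (2 ^ l - 1)]. *)
Lemma pow2_max_net l :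
  exists T : relu_net R (2 ^ l) l, (net_size T + 3 = 3 * 2 ^ l)%N /\
    forall x : 'cV[R]_(2 ^ l), is_max (fun i => x i 0) (net_eval T x 0 0).
Proof.
elim: l => [|l [T [sT eT]]].
  exists (Output 1%:M 0); split=> // x; rewrite /= mul1mx addr0.
  by split=> [i|]; [rewrite (ord1 i) | exists 0].
have loP (i : 'I_(2 ^ l)) : (i < 2 ^ l.+1)%N.
  by have := ltn_ord i; rewrite expnS; lia.
have hiP (i : 'I_(2 ^ l)) : (2 ^ l + i < 2 ^ l.+1)%N.
  by have := ltn_ord i; rewrite expnS; lia.
have /choice[N NP] := fun i => pair_max_net (Ordinal (loP i)) (Ordinal (hiP i)).
have [M [sM eM]] := net_compose N T.
exists M; split.
  rewrite sM (eq_bigr (fun=> 3%N)) => [|i _]; last by rewrite (NP i).1.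
  rewrite sum_nat_const card_ord expnS; lia.
move=> x; rewrite eM.
have [ub [i0 mE]] := eT (\col_i net_eval (N i) x 0 0).
set m := net_eval T _ 0 0 in ub mE *; split=> [k|].
  have [kl|kh] := ltnP k (2 ^ l).
    have := ub (Ordinal kl); rewrite mxE (NP _).2 ge_max => /andP[+ _].
    by congr (x _ _ <= _); apply: val_inj.
  have kP : (k - 2 ^ l < 2 ^ l)%N by rewrite ltn_subLR // addnn -mul2n -expnS.
  have := ub (Ordinal kP); rewrite mxE (NP _).2 ge_max => /andP[_].
  by congr (x _ _ <= _); apply: val_inj => /=; rewrite subnKC.
rewrite mE mxE (NP _).2.
have [_|_] := ltP (x (Ordinal (loP i0)) 0) (x (Ordinal (hiP i0)) 0).
  by exists (Ordinal (hiP i0)).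
by exists (Ordinal (loP i0)).
Qed.

Lemma ltn_expn_up_log r : (0 < r)%N -> (2 ^ up_log 2 r < 2 * r)%N.
Proof.
case: r => [|[|r]] // _.
have : (2 ^ (up_log 2 r.+2).-1 < r.+2)%N by rewrite up_log_gtn.
have : (0 < up_log 2 r.+2)%N by rewrite up_log_gt0.
by case: (up_log 2 r.+2) => // k _; rewrite expnS ltn_pmul2l.
Qed.

(** The entries are padded by repetition to a power of two, which is at most
    twice their number. *)
Lemma max_net r : (0 < r)%N ->
  exists T : relu_net R r (up_log 2 r), (net_size T <= 6 * r)%N /\
    forall x : 'cV[R]_r, is_max (fun i => x i 0) (net_eval T x 0 0).
Proof.
case: r => // r _; have [T [sT eT]] := pow2_max_net (up_log 2 r.+1).
have rle : (r.+1 <= 2 ^ up_log 2 r.+1)%N by apply: up_logP.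
pose h (i : 'I_(2 ^ up_log 2 r.+1)) : 'I_r.+1 := inord i.
have hS i : exists j, h j = i.
  exists (widen_ord rle i); apply: val_inj.
  by rewrite /h /= inord_val.
have [N [sN eN]] := net_precomp T (rowsub h 1%:M) 0.
exists N; split=> [|x].
  by rewrite sN; have := ltn_expn_up_log (ltn0Sn r); lia.
rewrite eN; apply/(is_max_surj _ _ hS).
have := eT (rowsub h 1%:M *m x + 0); rewrite addr0 -rowsubE.
by under [X in is_max X]eq_fun do rewrite mxE.
Qed.

End Networks.

(** * Reduction of a maximum to maxima of few functions *)

Section MaxReduction.
Variables (R : realType) (T : Type) (I : finType) (g : I -> T -> R).

(** The value on the empty set is arbitrary. *)
Definition setmax (A : {set I}) (x : T) : R :=
  if [pick i in A] is Some i0 then g [arg max_(i > i0 in A) g i x]%O x else 0.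

Lemma setmaxP (A : {set I}) x : A != finset.set0 ->
  (forall i, i \in A -> g i x <= setmax A x) /\
  exists2 i, i \in A & setmax A x = g i x.
Proof.
move=> /set0Pn[j jA]; rewrite /setmax; case: pickP => [i0 i0A|/(_ j)]; last first.
  by rewrite jA.
by case: arg_maxP => // i iA iM; split=> //; exists i.
Qed.

Lemma setmax_eq (A : {set I}) x m :
  (forall i, i \in A -> g i x <= m) -> (exists2 i, i \in A & m = g i x) ->
  setmax A x = m.
Proof.
move=> um [i iA mE].
have [|us [j jA sE]] := @setmaxP A x; first by apply/set0Pn; exists i.
by apply/eqP; rewrite eq_le {1}sE um // mE us.
Qed.

(** If [j] in [N] is dominated by a member of [P], adding [j] to [A] or
    removing it does not change the maximum over [P :|: A] but flips the sign;
    the terms cancel in pairs. *)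
Lemma setmax_incl_excl (P N : {set I}) x :
  (exists2 j, j \in N & exists2 i, i \in P & g j x <= g i x) ->
  \sum_(A : {set I} | A \subset N) (-1) ^+ #|A| * setmax (P :|: A) x = 0.
Proof.
move=> [j jN [i iP gji]].
pose h (A : {set I}) := if j \in A then A :\ j else j |: A.
have hK : involutive h.
  move=> A; rewrite /h; case: (boolP (j \in A)) => jA.
    by rewrite in_setD1 eqxx /= finset.setD1K.
  by rewrite finset.setU11 finset.setU1K.
(* The involution [h] turns the sum into its opposite. *)
set S := (X in X = 0); suff : S = - S by lra.
rewrite {1}/S (reindex_inj (inv_inj hK)) /S -sumrN.
apply: eq_big => [A|A _].
  rewrite /h; case: ifPn => jA; last by rewrite finset.subUset finset.sub1set jN.
  by rewrite finset.subDset (finset.setUidPr _) // finset.sub1set.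
have hmax : setmax (P :|: h A) x = setmax (P :|: A) x.
  have PA0 : P :|: A != finset.set0.
    by apply/set0Pn; exists i; rewrite inE iP.
  have [ub [k kPA mE]] := setmaxP x PA0.
  apply: setmax_eq; [move=> l|].
    rewrite !inE => /orP[lP|]; first by apply: ub; rewrite inE lP.
    rewrite /h; case: ifP => jA; rewrite !inE.
      by move=> /andP[_ lA]; apply: ub; rewrite inE lA orbT.
    move=> /orP[/eqP->|lA]; last by apply: ub; rewrite inE lA orbT.
    by apply: (le_trans gji); apply: ub; rewrite inE iP.
  have [kj|kj] := eqVneq k j; last first.
    exists k; rewrite ?mE //; move: kPA; rewrite !inE => /orP[-> //|kA].
    by rewrite /h; case: ifP => jA; rewrite !inE kA (negPf kj) /= !orbT.
  exists i; first by rewrite inE iP.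
  apply/eqP; rewrite eq_le mE {1}kj gji /= -mE.
  by apply: ub; rewrite inE iP.
rewrite hmax -mulNr; congr (_ * _); rewrite /h; case: ifP => jA.
  by rewrite (cardsD1 j A) jA exprS mulN1r opprK.
by rewrite cardsU1 jA exprS mulN1r.
Qed.

Variable n : nat.

(** Subsets of at most [n] elements are represented as images of maps from
    ['I_n]; this bounds the number of terms by [#|I| ^ n] and gives all terms
    the same shape, that of a maximum of [n] functions. *)
Definition comb_of_maxes (u : T -> R) : Prop :=
  exists c : {ffun 'I_n -> I} -> R,
    forall x, u x = \sum_(h : {ffun 'I_n -> I}) c h * setmax (h @: 'I_n) x.

Lemma comb_of_maxesZ a u : comb_of_maxes u -> comb_of_maxes (fun x => a * u x).
Proof.
move=> [c uE]; exists (fun h => a * c h) => x.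
by rewrite uE mulr_sumr; apply: eq_bigr => h _; rewrite mulrA.
Qed.

Lemma comb_of_maxes_sum (J : finType) (Q : pred J) (u : J -> T -> R) :
  (forall j, Q j -> comb_of_maxes (u j)) ->
  comb_of_maxes (fun x => \sum_(j | Q j) u j x).
Proof.
move=> uP; have /choice[c cP] : forall j, exists c : {ffun 'I_n -> I} -> R,
    Q j -> forall x, u j x =
      \sum_(h : {ffun 'I_n -> I}) c h * setmax (h @: 'I_n) x.
  move=> j; case: (boolP (Q j)) => Qj; last by exists (fun=> 0).
  by have [c cE] := uP j Qj; exists c.
exists (fun h => \sum_(j | Q j) c j h) => x.
rewrite (eq_bigr _ (fun j Qj => cP j Qj x)) exchange_big /=.
by apply: eq_bigr => h _; rewrite mulr_suml.
Qed.

Lemma comb_of_maxes_small (A : {set I}) : A != finset.set0 -> (#|A| <= n)%N ->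
  comb_of_maxes (setmax A).
Proof.
move=> /set0Pn[i0 i0A] An.
(* Positions beyond the cardinal of [A] repeat [i0], which is in [A]. *)
pose h : {ffun 'I_n -> I} := [ffun k : 'I_n => nth i0 (enum A) k].
have hA : h @: 'I_n = A.
  apply/setP => i; apply/imsetP/idP => [[k _ ->]|iA].
    rewrite ffunE; have [kA|kA] := ltnP k (size (enum A)).
      by rewrite -mem_enum mem_nth.
    by rewrite nth_default.
  have iP : (index i (enum A) < n)%N.
    by apply: leq_trans An; rewrite cardE index_mem mem_enum.
  by exists (Ordinal iP) => //; rewrite ffunE /= nth_index // mem_enum.
exists (fun h' => (h' == h)%:R) => x.
rewrite (bigD1 h) //= eqxx mul1r hA big1 ?addr0 // => h' /negPf ->.
by rewrite mul0r.
Qed.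

(** Induction on the size of [A]: once it exceeds [n], the vanishing alternating
    sum, solved for its term with all of [N], expresses the maximum over [A]
    by maxima over proper subsets.  The part [N] has to be the same at all
    points, the dominated member [j] need not be. *)
Lemma setmax_comb :
  (forall S : {set I}, (n < #|S|)%N -> exists N : {set I},
     [/\ N \subset S, S :\: N != finset.set0 & forall x,
       exists2 j, j \in N & exists2 i, i \in S :\: N & g j x <= g i x]) ->
  forall A : {set I}, A != finset.set0 -> comb_of_maxes (setmax A).
Proof.
move=> radon A; have [m] := ubnP #|A|; elim: m A => // m IHm S Sm S0.
have [Sn|nS] := leqP #|S| n; first exact: comb_of_maxes_small.
have [N [NS]] := radon S nS; set P := S :\: N => P0 gPN.
have PN : P :|: N = S.
  apply/setP => i; rewrite !inE.
  by case: (boolP (i \in N)) => [/(fintype.subsetP NS) ->|_]; rewrite ?orbF ?orbT.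
have -> : setmax S = fun x => \sum_(A : {set I} | (A \subset N) && (A != N))
    (- (-1) ^+ #|N| * (-1) ^+ #|A|) * setmax (P :|: A) x.
  apply/funext => x; have := setmax_incl_excl (gPN x).
  rewrite (bigD1 N) ?subxx //= PN => /eqP; rewrite addr_eq0 => /eqP.
  move=> /(congr1 (fun y => (-1) ^+ #|N| * y)); rewrite mulrA -exprD.
  rewrite -signr_odd oddD addbb mul1r => ->.
  rewrite mulrN -mulNr mulr_sumr; apply: eq_bigr => A _.
  by rewrite mulrA.
apply: comb_of_maxes_sum => A /andP[AN AneN].
apply: comb_of_maxesZ; apply: IHm; last first.
  by have /set0Pn[i iP] := P0; apply/set0Pn; exists i; rewrite inE iP.
rewrite -ltnS; apply: leq_trans Sm; rewrite ltnS; apply: proper_card.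
have pA : A \proper N by rewrite finset.properEneq AneN.
have [_ [j jN jA]] := properP pA.
apply/properP; split; first by rewrite -PN finset.setUS.
exists j; first by rewrite -PN inE jN orbT.
by rewrite !inE (negPf jA) jN.
Qed.

End MaxReduction.

(** * A Radon property of affine functions *)

Section AffineRadon.
Variables (R : realType) (d : nat) (I : finType).
Variables (a : I -> 'cV[R]_d) (b : I -> R).

Let g i x := dotv (a i) x + b i.

(** More than [d + 1] vectors [(1, a i)] of dimension [d + 1] are linearly
    dependent. *)
Lemma affine_dependence (S : {set I}) : (d.+1 < #|S|)%N ->
  exists la : I -> R, [/\ exists2 i, i \in S & la i != 0,
    \sum_(i in S) la i = 0 & forall k, \sum_(i in S) la i * a i k 0 = 0].
Proof.
move=> dS.
have [i0 i0S] : exists i0, i0 \in S.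
  by apply/set0Pn; rewrite -finset.card_gt0; apply: leq_trans dS.
pose M : 'M[R]_(#|S|, 1 + d) := \matrix_(i, j) (col_mx 1%:M (a (enum_val i))) j 0.
have : kermx M != 0.
  rewrite kermx_eq0 /row_free neq_ltn; apply/orP; left.
  by apply: leq_ltn_trans dS; apply: rank_leq_col.
move=> /rowV0Pn[v /sub_kermxP vM v0].
pose la i := v 0 (enum_rank_in i0S i).
have sE (F : I -> R) :
    \sum_(i in S) la i * F i = \sum_(k < #|S|) v 0 k * F (enum_val k).
  rewrite big_enum_val; apply: eq_bigr => k _.
  by rewrite /la enum_valK_in.
have vME j : \sum_(k < #|S|) v 0 k * (col_mx 1%:M (a (enum_val k))) j 0 = 0.
  have := congr1 (fun A : 'rV_(1 + d) => A 0 j) vM; rewrite !mxE.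
  by under eq_bigr do rewrite mxE.
exists la; split.
- have [k vk] : exists k, v 0 k != 0 by apply/rV0Pn.
  exists (enum_val k); first exact: enum_valP.
  by rewrite /la enum_valK_in.
- rewrite -(eq_bigr _ (fun i _ => mulr1 (la i))) sE.
  rewrite -[RHS](vME (lshift d 0)); apply: eq_bigr => k _.
  by rewrite col_mxEu mxE eqxx.
- move=> k; rewrite (sE (fun i => a i k 0)) -[RHS](vME (rshift 1 k)).
  by apply: eq_bigr => l _; rewrite col_mxEd.
Qed.

(** Take an affine dependence of the gradients, signed so that the same
    combination [c] of the constants is nonnegative, and let [N] be the indices
    with negative coefficient.  If at [x] all of [N] exceeded the maximum [M]
    of the others, then the combination of the [g k x - M], which equals [c],
    would have only nonpositive terms and a negative one. *)
Lemma affine_radon (S : {set I}) : (d.+1 < #|S|)%N -> exists N : {set I},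
  [/\ N \subset S, S :\: N != finset.set0 & forall x,
    exists2 j, j \in N & exists2 i, i \in S :\: N & g j x <= g i x].
Proof.
move=> dS.
have [la [[i1 i1S la1] la_sum la_a la_b]] : exists la : I -> R,
    [/\ exists2 i, i \in S & la i != 0, \sum_(i in S) la i = 0,
     forall k, \sum_(i in S) la i * a i k 0 = 0
     & 0 <= \sum_(i in S) la i * b i].
  have [la [[i1 i1S la1] la_sum la_a]] := affine_dependence dS.
  have [c0|c0] := leP 0 (\sum_(i in S) la i * b i).
    by exists la; split=> //; exists i1.
  exists (fun i => - la i); split.
  - by exists i1 => //; rewrite oppr_eq0.
  - by rewrite sumrN la_sum oppr0.
  - by move=> k; under eq_bigr do rewrite mulNr; rewrite sumrN la_a oppr0.
  - by under eq_bigr do rewrite mulNr; rewrite sumrN oppr_ge0 ltW.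
exists [set i in S | la i < 0]%SET; set N := [set i in S | la i < 0]%SET.
have NS : N \subset S by apply/fintype.subsetP => i; rewrite inE => /andP[].
have [j0 j0N] : exists j, j \in N.
  apply/set0Pn; apply: contra la1 => /eqP N0.
  apply/eqP; apply: (psumr_eq0P _ la_sum i1S) => i iS.
  by rewrite leNgt; apply/negP => lai; have := finset.in_set0 i; rewrite -N0 inE iS lai.
have [i0 i0P] : exists i, i \in S :\: N.
  apply/set0Pn; apply: contra la1 => /eqP P0.
  have la_sum' : \sum_(i in S) - la i = 0 by rewrite sumrN la_sum oppr0.
  rewrite -oppr_eq0; apply/eqP; apply: (psumr_eq0P _ la_sum' i1S) => i iS.
  rewrite oppr_ge0 leNgt; apply/negP => lai.
  by have := finset.in_set0 i; rewrite -P0 !inE iS ltNge (ltW lai).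
split=> //; first by apply/set0Pn; exists i0.
move=> x; have [i iP iM] := arg_maxP (g^~ x) i0P.
have g_sum : \sum_(k in S) la k * (g k x - g i x) = \sum_(k in S) la k * b k.
  under eq_bigr do rewrite mulrBr mulrDr.
  rewrite sumrB big_split /= -[X in _ - X]mulr_suml la_sum mul0r subr0.
  rewrite (_ : \sum_(k in S) la k * dotv (a k) x = 0) ?add0r //.
  under eq_bigr do rewrite mulr_sumr.
  rewrite exchange_big big1 //= => l _.
  under eq_bigr do rewrite mulrA.
  by rewrite -mulr_suml la_a mul0r.
apply: contrapT => noj.
have gN j : j \in N -> g i x < g j x.
  move=> jN; rewrite ltNge; apply/negP => gji.
  by apply: noj; exists j => //; exists i.
have term_le k : k \in S -> 0 <= - (la k * (g k x - g i x)).
  move=> kS; rewrite oppr_ge0; have [lak|lak] := ltP (la k) 0.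
    rewrite nmulr_rle0 // subr_ge0 ltW //; apply: gN.
    by rewrite inE kS lak.
  have kP : k \in S :\: N by rewrite !inE kS ltNge lak.
  by rewrite mulr_ge0_le0 // subr_le0; apply: iM kP.
have : la j0 * (g j0 x - g i x) < 0.
  have := j0N; rewrite inE => /andP[_ laj].
  by rewrite nmulr_rlt0 // subr_gt0 gN.
apply/negP; rewrite -leNgt; apply: le_trans la_b _.
rewrite -g_sum (bigD1 j0) ?(fintype.subsetP NS) //= gerDl.
rewrite -oppr_ge0 -sumrN; apply: sumr_ge0 => k /andP[kS _].
exact: term_le.
Qed.

End AffineRadon.

(** * The network of a maximum of affine functions *)

Section MaxAffineNetwork.
Variables (R : realType) (d : nat).

(** The size bound adds [r * s ^ d.+1] trees of at most [6 * d.+1] neurons, one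
    for each group and each tuple of length [d.+1] in it, and one tree of at
    most [6 * r]. *)
Lemma max_affine_net (k r s : nat) (a : 'I_k -> 'cV[R]_d) (b : 'I_k -> R)
    (f : 'cV[R]_d -> R) :
  (forall x, is_max (fun i => dotv (a i) x + b i) (f x)) ->
  (0 < r)%N -> (0 < s)%N -> (k <= r * s)%N ->
  exists N : relu_net R d (up_log 2 d.+1 + up_log 2 r),
    represents N f /\ (net_size N <= 6 * d.+2 * (r * s ^ d.+1))%N.
Proof.
move=> fmax r0 s0 krs.
have k0 : (0 < k)%N by have [_ [i _]] := fmax 0; apply: leq_trans (ltn_ord i).
case: k k0 a b fmax krs => // k _ a b fmax krs.
pose g i x := dotv (a i) x + b i.
(* Functions are numbered group by group; the numbers from [k.+1] on are
   spare places, all filled with function 0. *)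
pose psi (p : 'I_r * 'I_s) : 'I_k.+1 := inord (p.1 * s + p.2).
have psiS i : exists p, psi p = i.
  have iq : (i %/ s < r)%N.
    by rewrite ltn_divLR //; apply: leq_trans krs.
  have im : (i %% s < s)%N by rewrite ltn_mod.
  exists (Ordinal iq, Ordinal im); rewrite /psi /= -divn_eq.
  exact: inord_val.
pose H := {ffun 'I_d.+1 -> 'I_s}.
pose gr (i : 'I_r) (j : 'I_s) := g (psi (i, j)).
pose F i x := setmax (gr i) [set: 'I_s]%SET x.
have s_set0 : [set: 'I_s]%SET != finset.set0.
  by apply/set0Pn; exists (Ordinal s0); rewrite inE.
have /choice[c cE] : forall i, exists c : H -> R,
    forall x, F i x = \sum_h c h * setmax (gr i) (h @: 'I_d.+1) x.
  by move=> i; apply: setmax_comb => // S dS; apply: affine_radon.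
have [Td [sTd eTd]] := max_net R (ltn0Sn d).
have [Tr [sTr eTr]] := max_net R r0.
have /choice[N NP] := fun q : 'I_r * H => net_precomp Td
  (\matrix_(l, j) a (psi (q.1, q.2 l)) j 0) (\col_l b (psi (q.1, q.2 l))).
have NE q x : net_eval (N q) x 0 0 = setmax (gr q.1) (q.2 @: 'I_d.+1) x.
  rewrite (NP q).2; set y := _ + _.
  have yE l : y l 0 = gr q.1 (q.2 l) x.
    by rewrite !mxE; congr (_ + _); apply: eq_bigr => j _; rewrite mxE.
  have [ub [l mE]] := eTd y; apply/esym/setmax_eq.
    by move=> _ /imsetP[l' _ ->]; rewrite -yE.
  by exists (q.2 l); [apply: imset_f | rewrite mE yE].
(* Row [i] of [C] combines the tuples of group [i] only. *)
pose C : 'M[R]_(r, #|{: 'I_r * H}|) := \matrix_(i, p)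
  (if (enum_val p).1 == i then c i (enum_val p).2 else 0).
have [T [sT eT]] := net_precomp Tr C 0.
have [M [sM eM]] := net_compose (fun p : 'I_#|{: 'I_r * H}| => N (enum_val p)) T.
exists M; split.
  move=> x; apply: (is_max_uniq (fmax x)); rewrite eM eT.
  set y := _ + _.
  have yE i : y i 0 = F i x.
    rewrite cE !mxE addr0.
    rewrite (eq_bigr (fun p => (if (enum_val p).1 == i
      then c i (enum_val p).2 else 0) *
        setmax (gr (enum_val p).1) ((enum_val p).2 @: 'I_d.+1) x)); last first.
      by move=> p _; rewrite !mxE NE.
    rewrite -(big_enum_val (fun q => (if q.1 == i then c i q.2 else 0) *
        setmax (gr q.1) (q.2 @: 'I_d.+1) x)).
    rewrite -(pair_bigA _ (fun i' h => (if i' == i then c i h else 0) *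
        setmax (gr i') (h @: 'I_d.+1) x)) /=.
    rewrite (bigD1 i) //= eqxx [X in _ + X]big1 ?addr0 // => i' /negPf i'i.
    by apply: big1 => h _; rewrite i'i mul0r.
  have [ub [i mE]] := eTr y; split.
    move=> k'; have [[i' j] <-] := psiS k'.
    apply: le_trans (ub i'); rewrite yE.
    by apply: (setmaxP (gr i') x s_set0).1; rewrite inE.
  rewrite mE yE /F; have [_ [j _ ->]] := setmaxP (gr i) x s_set0.
  by exists (psi (i, j)).
rewrite sM sT; under eq_bigr do rewrite (NP _).1.
rewrite sum_nat_const card_ord card_prod card_ffun !card_ord.
have s1 : (0 < s ^ d.+1)%N by rewrite expn_gt0 s0.
nia.
Qed.

End MaxAffineNetwork.

(** * Enumerations of finite sets *)

Lemma card_eq_ordP (T : Type) (A : set T) (k : nat) :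
  (A #= `I_k)%card <-> exists e : 'I_k -> T, injective e /\ A = range e.
Proof.
split=> [Ak|[e [inje ->]]]; last first.
  have eT : (range e #= [set: 'I_k])%card.
    by apply: inj_card_eq => x y _ _; apply: inje.
  by apply: card_eq_trans eT _; rewrite card_eq_sym; apply: card_II.
have : ([set: 'I_k] #= A)%card by rewrite card_eq_sym; apply: card_eq_trans Ak card_II.
move=> /card_bijP[h [h' hK h'K]].
exists (fun i => set_val (h (to_setT i))); split.
  by move=> i j /val_inj /(can_inj hK) /(congr1 val).
apply/seteqP; split=> [x Ax|x [i _ <-]]; last exact: set_valP.
exists (set_val (h' (SigSub (mem_set Ax)))) => //.
have -> : to_setT (set_val (h' (SigSub (mem_set Ax)))) = h' (SigSub (mem_set Ax)).
  exact: val_inj.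
by rewrite h'K.
Qed.

(** * Affine functions and generic points *)

Section AffineFunctions.
Variables (R : realType) (d : nat).
Local Notation E := 'cV[R]_d.
Implicit Types (g h : E -> R) (x y p : E).

Lemma dotvDZ (a x y : E) t : dotv a (x + t *: y) = dotv a x + t * dotv a y.
Proof.
rewrite /dotv mulr_sumr -big_split /=; apply: eq_bigr => i _.
by rewrite !mxE mulrDr mulrCA.
Qed.

Lemma dotvDl (a b x : E) : dotv (a + b) x = dotv a x + dotv b x.
Proof. by rewrite /dotv -big_split; apply: eq_bigr => i _; rewrite mxE mulrDl. Qed.

Lemma dotvNl (a x : E) : dotv (- a) x = - dotv a x.
Proof. by rewrite /dotv -sumrN; apply: eq_bigr => i _; rewrite mxE mulNr. Qed.

Lemma dotv0l x : dotv 0 x = 0 :> R.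
Proof. by rewrite /dotv big1 // => i _; rewrite mxE mul0r. Qed.

Lemma dotv0r (a : E) : dotv a 0 = 0.
Proof. by rewrite /dotv big1 // => i _; rewrite mxE mulr0. Qed.

Lemma affine_fun_cst (c : R) : affine_fun (fun _ : E => c).
Proof. by exists 0, c => x; rewrite dotv0l add0r. Qed.

Lemma affine_funB g h : affine_fun g -> affine_fun h ->
  affine_fun (fun x => g x - h x).
Proof.
move=> [a [b gE]] [a' [b' hE]]; exists (a - a'), (b - b') => x.
by rewrite gE hE dotvDl dotvNl; ring.
Qed.

Lemma affine_fun_sum (I : finType) (Q : pred I) (g : I -> E -> R) :
  (forall i, affine_fun (g i)) -> affine_fun (fun x => \sum_(i | Q i) g i x).
Proof.
move=> /choice[a /choice[b gE]].
exists (\sum_(i | Q i) a i), (\sum_(i | Q i) b i) => x.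
under eq_bigr do rewrite gE.
rewrite big_split /=; congr (_ + _).
elim/big_rec2: _ => [|i s v _ ->]; first by rewrite dotv0l.
by rewrite dotvDl.
Qed.

Lemma affine_fun_seg g p y t : affine_fun g ->
  g (p + t *: (y - p)) = g p + t * (g y - g p).
Proof.
move=> [a [b gE]]; rewrite !gE dotvDZ.
by rewrite -scaleN1r dotvDZ; ring.
Qed.

Lemma affine_fun_comb g (J : finType) (w : J -> R) (p : J -> E) :
  affine_fun g -> \sum_j w j = 1 ->
  g (\sum_j w j *: p j) = \sum_j w j * g (p j).
Proof.
move=> [a [b gE]] w1; rewrite gE; under [RHS]eq_bigr do rewrite gE mulrDr.
rewrite big_split /= -mulr_suml w1 mul1r; congr (_ + _).
elim/big_rec2: _ => [|j s v _ <-]; first by rewrite dotv0r.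
by rewrite [in LHS]addrC dotvDZ addrC.
Qed.

(** An affine function commutes with affine combinations, so its values on [P]
    determine those on the affine hull. *)
Lemma agree_on_full_dimensional (P : set E) g h :
  full_dimensional P -> affine_fun g -> affine_fun h -> agree_on P g h -> g = h.
Proof.
move=> PT ag ah gh; apply/funext => x.
have : affine_hull P x by rewrite PT.
move=> [m [w [p [Pp w1 ->]]]]; rewrite !affine_fun_comb //.
by apply: eq_bigr => i _; rewrite gh.
Qed.

(** A curve starting at [x] which meets every hyperplane at most finitely often:
    along it an affine function that is not identically zero is a nonzero
    polynomial in the parameter.  Its points for small [t > 0] are therefore
    generic with respect to any finite family of hyperplanes. *)
Definition moment_curve x (t : R) : E := x + \col_i t ^+ i.+1.

Lemma moment_curve_poly g x : affine_fun g ->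
  exists q : {poly R}, [/\ forall t, g (moment_curve x t) = q.[t], q.[0] = g x
    & (exists y, g y != 0) -> q != 0].
Proof.
move=> [a [b gE]].
pose q : {poly R} := (g x)%:P + \sum_(i < d) a i 0 *: 'X^(i.+1).
have qE t : g (moment_curve x t) = q.[t].
  rewrite /q hornerD hornerC horner_sum gE /moment_curve.
  rewrite -[X in dotv a (x + X)]scale1r dotvDZ mul1r.
  rewrite addrAC -gE; congr (_ + _); apply: eq_bigr => i _.
  by rewrite mxE hornerZ hornerXn.
have q0 : q.[0] = g x.
  rewrite /q hornerD hornerC horner_sum big1 ?addr0 // => i _.
  by rewrite hornerZ hornerXn exprS mul0r mulr0.
exists q; split=> // -[y]; apply: contra => /eqP qz.
have qC (j : 'I_d) : q`_j.+1 = a j 0.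
  rewrite /q coefD coefC add0r coef_sum (bigD1 j) //= coefZ coefXn eqxx mulr1.
  rewrite big1 ?addr0 // => i ij.
  by rewrite coefZ coefXn eqSS (inj_eq val_inj) eq_sym (negPf ij) mulr0.
have a0 : a = 0 by apply/colP => j; rewrite -qC qz coef0 mxE.
have gy z : g z = b by rewrite gE a0 dotv0l add0r.
by rewrite gy -(gy x) -q0 qz horner0.
Qed.

(** Dividing out the root 0 reduces to a polynomial with nonzero constant
    term, where continuity applies. *)
Lemma near_poly_neq0 (q : {poly R}) : q != 0 -> \forall t \near 0^'+, q.[t] != 0.
Proof.
have [n] := ubnP (size q); elim: n q => // n IHn q qn q0.
have [q00|q00] := eqVneq q.[0] 0.
  have /factor_theorem[r qr] : root q 0 by apply/rootP.
  have r0 : r != 0 by apply: contraNneq q0; rewrite qr => ->; rewrite mul0r.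
  have rn : (size r < n)%N.
    by move: qn; rewrite qr subr0 size_mulX // ltnS.
  near=> t; rewrite qr hornerM mulf_neq0 //; first by near: t; apply: IHn.
  by rewrite hornerXsubC subr0 gt_eqF //; near: t; apply: nbhs_right_gt.
have qc : q.[t] @[t --> 0^'+] --> q.[0].
  by apply: cvg_at_right_filter; apply: continuous_horner.
exact: cvgr_neq0 _ qc q00.
Unshelve. all: by end_near. Qed.

Lemma near_poly_gt0 (q : {poly R}) : 0 < q.[0] -> \forall t \near 0^'+, 0 < q.[t].
Proof.
move=> q0; have qc : q.[t] @[t --> 0^'+] --> q.[0].
  by apply: cvg_at_right_filter; apply: continuous_horner.
exact: cvgr_gt _ qc _ q0.
Qed.

Lemma near_curve_gt0 g x : affine_fun g -> 0 < g x ->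
  \forall t \near 0^'+, 0 < g (moment_curve x t).
Proof.
move=> /(moment_curve_poly x)[q [qE q0 _]]; rewrite -q0 => /near_poly_gt0.
by apply: filterS => t; rewrite qE.
Qed.

Lemma near_curve_neq0 g x : affine_fun g -> (exists y, g y != 0) ->
  \forall t \near 0^'+, g (moment_curve x t) != 0.
Proof.
move=> /(moment_curve_poly x)[q [qE _ qN]] /qN /near_poly_neq0.
by apply: filterS => t; rewrite qE.
Qed.

Lemma near_seg_gt0 g p y : affine_fun g -> 0 < g p ->
  \forall t \near 0^'+, 0 < g (p + t *: (y - p)).
Proof.
move=> ag gp; pose q : {poly R} := (g p)%:P + (g y - g p) *: 'X.
have : 0 < q.[0] by rewrite !hornerE ?mulr0 ?addr0.
move=> /near_poly_gt0; apply: filterS => t.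
by rewrite affine_fun_seg // !hornerE mulrC.
Qed.

(** A relative interior point, as the barycentre of one witness of strictness
    for each [u i] and one more point of [Q]; the latter keeps the family
    nonempty when there is no [u i].  The first conclusion replaces the
    membership of the barycentre in the convex hull of [Q]. *)
Lemma exists_relint_point (I : finType) (u : I -> E -> R) (Q : set E) :
  (exists x, Q x) -> (forall i, affine_fun (u i)) ->
  (forall i x, Q x -> 0 <= u i x) ->
  exists p, (forall w, affine_fun w -> (forall x, Q x -> 0 <= w x) -> 0 <= w p) /\
    forall i, (exists2 x, Q x & 0 < u i x) -> 0 < u i p.
Proof.
move=> [q0 Qq0] au u0.
have /choice[q qP] : forall j : option I, exists x, Q x /\
    if j is Some i then (exists2 x, Q x & 0 < u i x) -> 0 < u i x else True.
  case=> [i|]; last by exists q0.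
  have [[x Qx ux]|no] := pselect (exists2 x, Q x & 0 < u i x).
    by exists x; split.
  by exists q0; split.
pose w (_ : option I) : R := #|{: option I}|%:R^-1.
have n0 : (0 < #|{: option I}|)%N by rewrite card_option.
have w0 j : 0 < w j by rewrite invr_gt0 ltr0n.
have w1 : \sum_j w j = 1.
  by rewrite sumr_const -[LHS]mulr_natr mulVf // pnatr_eq0 -lt0n.
exists (\sum_j w j *: q j); split=> [v av v0|i ui].
  rewrite affine_fun_comb //; apply: sumr_ge0 => j _.
  by apply: mulr_ge0; [apply: ltW | apply: v0; apply: (qP j).1].
rewrite affine_fun_comb // (bigD1 (Some i)) //=.
apply: ltr_wpDr; last by apply: mulr_gt0 => //; apply: (qP (Some i)).2.
apply: sumr_ge0 => j _.
by apply: mulr_ge0; [apply: ltW | apply: u0; apply: (qP j).1].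
Qed.

End AffineFunctions.

(** * Full-dimensional cells *)

Section Polyhedra.
Variables (R : realType) (d : nat).
Local Notation E := 'cV[R]_d.
Implicit Types (g h : E -> R) (x y p : E) (P Q : set E).

Lemma polyhedronP P : polyhedron P <-> exists (m : nat) (u : 'I_m -> E -> R),
  (forall i, affine_fun (u i)) /\ P = [set x | forall i, 0 <= u i x].
Proof.
split=> [[m [A [b ->]]]|[m [u [/choice[a /choice[b uE]] ->]]]].
  exists m, (fun i x => b i 0 - (A *m x) i 0); split=> [i|].
    exists (- (row i A)^T), (b i 0) => x; rewrite dotvNl addrC mxE.
    by congr (- _ + _); apply: eq_bigr => j _; rewrite !mxE.
  by apply/seteqP; split=> x /= Px i; have := Px i; rewrite subr_ge0.
exists m, (\matrix_(i, j) - a i j 0), (\col_i b i).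
have bE x i : ((\matrix_(i, j) - a i j 0) *m x) i 0 = - dotv (a i) x.
  by rewrite mxE -sumrN; apply: eq_bigr => j _; rewrite mxE mulNr.
by apply/seteqP; split=> x /= Px i; have := Px i; rewrite bE mxE uE; lra.
Qed.

Lemma polyhedron_fin (I : finType) (u : I -> E -> R) :
  (forall i, affine_fun (u i)) -> polyhedron [set x | forall i, 0 <= u i x].
Proof.
move=> au; apply/polyhedronP; exists #|I|, (fun k => u (enum_val k)).
split=> //; apply/seteqP; split=> x /= Px i; first exact: Px.
by rewrite -(enum_rankK i).
Qed.

Lemma full_dimensionalS P Q : P `<=` Q -> full_dimensional P -> full_dimensional Q.
Proof.
move=> PQ PT; apply/seteqP; split=> // x _.
have : affine_hull P x by rewrite PT.
by move=> [m [w [p [Pp w1 ->]]]]; exists m, w, p; split=> // i; apply: PQ.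
Qed.

(** For a polyhedron given by the inequalities [0 <= u i x], strict points are
    interior points; inequalities that are trivially satisfied with equality
    have to be exempted. *)
Definition strict_point (I : Type) (u : I -> E -> R) p : Prop :=
  forall i, (forall y, u i y = 0) \/ 0 < u i p.

Section Cell.
Variables (m : nat) (u : 'I_m -> E -> R).
Hypothesis au : forall i, affine_fun (u i).
Let P : set E := [set x | forall i, 0 <= u i x].

(** An inequality that is tight on all of [P] is tight on the affine hull, so
    in a full-dimensional [P] it is trivial. *)
Lemma full_dimensional_strict_point : full_dimensional P ->
  exists p, strict_point u p.
Proof.
move=> PT; have P0 : exists x, P x.
  have : affine_hull P 0 by rewrite PT.
  move=> [[|n] [w [p [Pp w1 _]]]]; last by exists (p ord0).
  by move: w1; rewrite big_ord0 => /esym/eqP; rewrite oner_eq0.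
have [p [_ pS]] := exists_relint_point P0 au (fun i x Px => Px i).
exists p => i; have [[x Px ux]|no] := pselect (exists2 x, P x & 0 < u i x).
  by right; apply: pS; exists x.
left => y; suff -> : u i = fun=> 0 by [].
apply: agree_on_full_dimensional PT (au i) (affine_fun_cst _ _) _ => x Px.
apply/eqP; rewrite eq_le (Px i) andbT leNgt; apply/negP => ux.
by apply: no; exists x.
Qed.

Lemma near_seg_strict_point p y : strict_point u p ->
  \forall t \near 0^'+, P (p + t *: (y - p)).
Proof.
move=> pS; apply: filter_forall => i.
have [ui0|uip] := pS i; first by apply: nearW => t; rewrite ui0.
by apply: filterS (near_seg_gt0 y (au i) uip) => t /ltW.
Qed.

Lemma near_curve_strict_point p : strict_point u p ->
  \forall t \near 0^'+, P (moment_curve p t).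
Proof.
move=> pS; apply: filter_forall => i.
have [ui0|uip] := pS i; first by apply: nearW => t; rewrite ui0.
by apply: filterS (near_curve_gt0 (au i) uip) => t /ltW.
Qed.

(** From a strict point [p] a short step towards [y] stays in [P], so [y] is
    on a line through two points of [P]. *)
Lemma strict_point_full_dimensional p : strict_point u p -> full_dimensional P.
Proof.
move=> pS; apply/seteqP; split=> // y _.
have [t [t0 Pt]] : exists t : R, 0 < t /\ P (p + t *: (y - p)).
  apply: (@filter_ex _ (0^'+)).
  near=> t; split; near: t; first exact: nbhs_right_gt.
  exact: near_seg_strict_point.
have Pp : P p by move=> i; case: (pS i) => [->//|/ltW].
exists 2%N, (fun i => if i == 0 then t^-1 else 1 - t^-1),
  (fun i => if i == 0 then p + t *: (y - p) else p); split.
- by move=> i; case: ifP.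
- by rewrite !big_ord_recl big_ord0 /=; ring.
rewrite !big_ord_recl big_ord0 /= addr0 scalerDr scalerA mulVf ?gt_eqF //.
by rewrite scale1r scalerBl scale1r; apply/colP => i; rewrite !mxE; ring.
Unshelve. all: by end_near. Qed.

(** For small [t] the curve avoids all hyperplanes bounding [P], so that it can
    be in [P] only at strict points; and it still violates the inequalities
    that [x] violates. *)
Lemma near_curve_cell x : \forall t \near 0^'+,
  P (moment_curve x t) -> full_dimensional P /\ P x.
Proof.
have ev i : \forall t \near 0^'+, 0 <= u i (moment_curve x t) ->
    ((forall y, u i y = 0) \/ 0 < u i (moment_curve x t)) /\ 0 <= u i x.
  have [ui0|ui] := pselect (forall y, u i y = 0).
    by apply: nearW => t _; split; [left | rewrite ui0].
  have ui' : exists y, u i y != 0.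
    by apply: contrapT => no; apply: ui => y; apply: contrapT => /eqP uy; apply: no; exists y.
  have nz := near_curve_neq0 x (au i) ui'.
  have [ux|ux] := leP 0 (u i x).
    by apply: filterS nz => t ut ut'; split=> //; right; rewrite lt_def ut.
  have aN : affine_fun (fun z => 0 - u i z).
    by apply: affine_funB (au i); apply: affine_fun_cst.
  have uN : 0 < 0 - u i x by rewrite sub0r oppr_gt0.
  apply: filterS (near_curve_gt0 aN uN) => t.
  by rewrite sub0r oppr_gt0 ltNge => /negP.
have : \forall t \near 0^'+, forall i, 0 <= u i (moment_curve x t) ->
    ((forall y, u i y = 0) \/ 0 < u i (moment_curve x t)) /\ 0 <= u i x.
  exact: filter_forall ev.
apply: filterS => t evt Pt.
split; last by move=> i; have [] := evt i (Pt i).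
apply: (@strict_point_full_dimensional (moment_curve x t)) => i.
by have [] := evt i (Pt i).
Qed.

End Cell.

Lemma finite_set_near (T : Type) (C : set T) (G : T -> R -> Prop) :
  finite_set C -> (forall c, C c -> \forall t \near 0^'+, G c t) ->
  \forall t \near 0^'+, forall c, C c -> G c t.
Proof.
move=> /finite_setP[n /card_eq_ordP[e [_ ->]]] CG.
have : \forall t \near 0^'+, forall i, G (e i) t.
  by apply: filter_forall => i; apply: CG; exists i.
by apply: filterS => t Gt _ [i _ <-].
Qed.

(** A generic point near [x] lies in some cell, and that cell contains [x]. *)
Lemma full_cells_cover (C : set (set E)) x : complete_complex C ->
  exists P, [/\ C P, full_dimensional P & P x].
Proof.
move=> [[Cfin Cpoly _ _] Ccov].
have : \forall t \near 0^'+, forall P, C P ->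
    P (moment_curve x t) -> full_dimensional P /\ P x.
  apply: finite_set_near => // P /Cpoly/polyhedronP[m [u [au ->]]].
  exact: near_curve_cell.
move=> nearC; have [t Ct] := @filter_ex _ _ (at_right_proper_filter 0) _ nearC.
have : (\bigcup_(P in C) P) (moment_curve x t) by rewrite Ccov.
by move=> [P CP /(Ct P CP)[PT Px]]; exists P.
Qed.

(** Otherwise a generic point in the interior of the cell that [h] comes from
    would lie in a full cell of [C] whose affine function differs from [h]
    there. *)
Lemma component_on_cell (f h : E -> R) (C : set (set E)) :
  compatible f C -> affine_component f h ->
  exists P, [/\ C P, full_dimensional P & agree_on P f h].
Proof.
move=> [Ccc Caff] [ah [C' [P' [[[[_ Cpoly' _ _] _] _] C'P' P'T fh]]]].
have /polyhedronP[m [u [au P'E]]] := Cpoly' _ C'P'.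
have [p pS] : exists p, strict_point u p.
  by apply: full_dimensional_strict_point => //; rewrite -P'E.
apply: contrapT => noP.
have Cfin : finite_set C by case: Ccc => -[].
have ev : \forall t \near 0^'+, forall P, C P -> full_dimensional P ->
    P (moment_curve p t) -> f (moment_curve p t) != h (moment_curve p t).
  apply: finite_set_near => // P CP.
  have [PT|nPT] := pselect (full_dimensional P); last exact: nearW.
  have [g [ag fg]] := Caff P CP.
  have gh : exists y, g y - h y != 0.
    apply: contrapT => no; apply: noP; exists P; split=> // y Py.
    rewrite fg //; apply: contrapT => /eqP gy; apply: no; exists y.
    by rewrite subr_eq0.
  apply: filterS (near_curve_neq0 p (affine_funB ag ah) gh) => t gt _ Pt.
  by rewrite fg // -subr_eq0.
have [t [Ct P't]] : exists t, (forall P, C P -> full_dimensional P ->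
    P (moment_curve p t) -> f (moment_curve p t) != h (moment_curve p t)) /\
    P' (moment_curve p t).
  apply: (@filter_ex _ (0^'+)).
  near=> t; split; near: t => //.
  by rewrite P'E; apply: near_curve_strict_point.
have [P [CP PT Pt]] := full_cells_cover (moment_curve p t) Ccc.
by have := Ct P CP PT Pt; rewrite fh // eqxx.
Unshelve. all: by end_near. Qed.

(** The chord from a strict point [p] of the cell of [h] to [y] lies above [f],
    and near [p] the graph of [f] is that of [h]. *)
Lemma component_le (f h : E -> R) : convex_function [set: E] f ->
  affine_component f h -> forall y, h y <= f y.
Proof.
move=> cf [ah [C' [P' [[[[_ Cpoly' _ _] _] _] C'P' P'T fh]]]] y.
have /polyhedronP[m [u [au P'E]]] := Cpoly' _ C'P'.
have [p pS] : exists p, strict_point u p.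
  by apply: full_dimensional_strict_point => //; rewrite -P'E.
have P'p : P' p by rewrite P'E => i; case: (pS i) => [->//|/ltW].
have [t [t0 t1 Pt]] : exists t : R, [/\ 0 < t, t < 1 & P' (p + t *: (y - p))].
  apply: (@filter_ex _ (0^'+)).
  near=> t; split; near: t; first exact: nbhs_right_gt.
    exact: nbhs_right_lt.
  by rewrite P'E; apply: near_seg_strict_point.
have := cf (Itv01 (ltW t0) (ltW t1)) y p (in_setT _) (in_setT _).
have -> : (conv (Itv01 (ltW t0) (ltW t1)) (y : convex_lmodType E) p)
    = p + t *: (y - p).
  rewrite /conv /=; apply/colP => i; rewrite !mxE /unstable.onem; ring.
rewrite convRE /= /unstable.onem (fh _ Pt) (fh _ P'p) (affine_fun_seg _ _ _ ah) => hf.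
rewrite -(ler_pM2l t0); lra.
Unshelve. all: by end_near. Qed.

End Polyhedra.

(** * The complex of active components *)

Section CanonicalComplex.
Variables (R : realType) (d k : nat).
Local Notation E := 'cV[R]_d.
Variables (f : E -> R) (g : 'I_k -> E -> R).
Hypothesis ag : forall i, affine_fun (g i).
Hypothesis fmax : forall x, is_max (g^~ x) (f x).

Definition active_cell (S : {set 'I_k}) : set E :=
  [set x | forall i, i \in S -> g i x = f x].

Definition active_complex : set (set E) :=
  [set P | P = set0 \/ exists2 S, S != finset.set0 & P = active_cell S].

Lemma le_fmax i x : g i x <= f x.
Proof. by have [] := fmax x. Qed.

Lemma active_fun i x : (forall j, g j x <= g i x) -> g i x = f x.
Proof.
move=> gi; apply/eqP; rewrite eq_le le_fmax /=.
by have [_ [j ->]] := fmax x.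
Qed.

Lemma active_cell_polyhedron S : polyhedron (active_cell S).
Proof.
pose u (p : 'I_k * 'I_k) x := if p.1 \in S then g p.1 x - g p.2 x else 0.
have -> : active_cell S = [set x | forall p, 0 <= u p x].
  apply/seteqP; split=> x Sx.
    move=> [i j]; rewrite /u /=; case: ifP => // iS.
    by rewrite subr_ge0 (Sx i iS) le_fmax.
  move=> i iS; apply: active_fun => j.
  by have := Sx (i, j); rewrite /u /= iS subr_ge0.
apply: polyhedron_fin => -[i j]; rewrite /u /=.
by case: (i \in S); [apply: affine_funB | apply: affine_fun_cst].
Qed.

Lemma set0_polyhedron : polyhedron (set0 : set E).
Proof.
have -> : (set0 : set E) = [set x | forall i : unit, 0 <= (-1 : R)].
  by apply/seteqP; split=> x //= /(_ tt); rewrite ler0N1.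
by apply: (polyhedron_fin (u := fun=> fun=> -1)) => _; apply: affine_fun_cst.
Qed.

Lemma face_set0 (P : set E) : face P set0.
Proof.
exists 0, 1; split=> [x _|]; first by rewrite dotv0l.
by apply/seteqP; split=> x //= -[_]; rewrite dotv0l => /esym/eqP; rewrite oner_eq0.
Qed.

(** With [i0] in [S], the sum over [T] of the [g j - g i0] is nonpositive
    where [g i0] is maximal, and vanishes only where all of [T] is active. *)
Lemma active_cell_face (S T : {set 'I_k}) : S != finset.set0 -> S \subset T ->
  face (active_cell S) (active_cell T).
Proof.
move=> /set0Pn[i0 i0S] /fintype.subsetP ST.
have [c [b wE]] : affine_fun (fun x => \sum_(j in T) (g j x - g i0 x)).
  by apply: affine_fun_sum => j; apply: affine_funB.
have w0 x j : active_cell S x -> j \in T -> 0 <= - (g j x - g i0 x).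
  by move=> /(_ i0 i0S) -> _; rewrite oppr_ge0 subr_le0 le_fmax.
exists c, (- b); split=> [x Sx|].
  rewrite -subr_le0 opprK -wE -oppr_ge0 -sumrN.
  by apply: sumr_ge0 => j jT; apply: w0.
apply/seteqP; split=> [x Tx|x [Sx]].
  split; first by move=> i /ST iT; apply: Tx.
  apply/eqP; rewrite -subr_eq0 opprK -wE big1 // => j jT.
  by rewrite !Tx ?subrr //; apply: ST.
move=> /= /eqP; rewrite -subr_eq0 opprK -wE -oppr_eq0 -sumrN => /eqP s0 j jT.
have /eqP := psumr_eq0P (fun j jT => w0 x j Sx jT) s0 jT.
by rewrite oppr_eq0 subr_eq0 => /eqP ->; apply: Sx.
Qed.

(** A nonempty face [F] is the cell of the set [T] of all components that are
    active on all of [F].  For [x] in that cell and a relative interior point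
    [p] of [F], the segment from [x] to [p] extends a little beyond [p] inside
    the cell, since the components outside [T] are strictly inactive at [p].
    The functional that exposes [F] is maximal at [p], hence constant on the
    segment, and [x] is in [F]. *)
Lemma face_active_cell (S : {set 'I_k}) (F : set E) :
  S != finset.set0 -> face (active_cell S) F -> active_complex F.
Proof.
move=> S0 [c [beta [cS FE]]]; have /set0Pn[i0 i0S] := S0.
have [F0|] := pselect (exists x, F x); last first.
  move=> noF; left; apply/seteqP; split=> x // Fx.
  by apply: noF; exists x.
right.
pose T := [set i | `[< forall x, F x -> g i x = f x >]]%SET.
have FS x : F x -> active_cell S x by rewrite FE => -[].
have Fc x : F x -> dotv c x = beta by rewrite FE => -[].
have ST i : i \in S -> i \in T.
  by move=> iS; rewrite inE; apply/asboolP => x /FS; apply.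
have i0T := ST i0 i0S; exists T; first by apply/set0Pn; exists i0.
apply/seteqP; split=> [x Fx i|x Tx]; first by rewrite inE => /asboolP; apply.
have [p [pF pS]] : exists p, (forall w, affine_fun w ->
      (forall x, F x -> 0 <= w x) -> 0 <= w p) /\
    forall i, (exists2 x, F x & 0 < g i0 x - g i x) -> 0 < g i0 p - g i p.
  apply: (@exists_relint_point _ _ _ (fun i x => g i0 x - g i x)) => //.
    by move=> i; apply: affine_funB.
  by move=> i y /FS Sy; rewrite (Sy i0 i0S) subr_ge0 le_fmax.
(* The functional that exposes [F], with either sign, to get equality at [p]. *)
have ac (s : R) : affine_fun (fun y => s * (dotv c y - beta)).
  exists (s *: c), (- (s * beta)) => y; rewrite mulrBr; congr (_ - _).
  by rewrite /dotv mulr_sumr; apply: eq_bigr => i _; rewrite mxE mulrA.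
have pc : dotv c p = beta.
  apply/eqP; rewrite -subr_eq0 eq_le.
  have := pF _ (ac 1) _; rewrite mul1r => ->; last first.
    by move=> y /Fc ->; rewrite subrr mulr0.
  have := pF _ (ac (-1)) _; rewrite mulN1r oppr_ge0 => -> //.
  by move=> y /Fc ->; rewrite subrr mulr0.
have pT i : i \in T -> g i p = f p.
  rewrite inE => /asboolP iF; apply: active_fun => j; rewrite -subr_ge0.
  apply: (pF (fun y => g i y - g j y)); first exact: affine_funB.
  by move=> y Fy; rewrite iF // subr_ge0 le_fmax.
have pNT j : j \notin T -> 0 < g i0 p - g j p.
  rewrite inE => /asboolPn jF; apply: pS; apply: contrapT => no.
  apply: jF => y Fy; apply/eqP; rewrite eq_le le_fmax /= -(FS y Fy i0 i0S).
  by rewrite -subr_le0 leNgt; apply/negP => gy; apply: no; exists y.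
have [t [t0 zS]] : exists t : R, 0 < t /\
    forall j, j \notin T -> 0 < g i0 (p + t *: (p + p - x - p)) -
      g j (p + t *: (p + p - x - p)).
  apply: (@filter_ex _ (0^'+)).
  near=> t; split; first by near: t; apply: nbhs_right_gt.
  near: t; apply: filter_forall => j; have [jT|jT] := boolP (j \in T).
    by apply: nearW.
  have := near_seg_gt0 (p + p - x) (affine_funB (ag i0) (ag j)) (pNT j jT).
  by apply: filterS.
(* [p + p - x] is the reflection of [x] in [p]. *)
set z := p + t *: (p + p - x - p) in zS.
have zE w : affine_fun w -> w z = w p + t * (w p - w x).
  move=> aw; rewrite /z affine_fun_seg //.
  have -> : p + p - x = x + 2 *: (p - x).
    by apply/colP => i; rewrite !mxE; ring.
  by rewrite affine_fun_seg //; ring.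
have zi0 : forall j, g j z <= g i0 z.
  move=> j; have [jT|jT] := boolP (j \in T); last first.
    by rewrite -subr_ge0 ltW // zS.
  by rewrite (zE _ (ag j)) (zE _ (ag i0)) !pT // !Tx.
have zSa : active_cell S z.
  move=> i iS; rewrite -(active_fun zi0) (zE _ (ag i)) (zE _ (ag i0)).
  by rewrite !pT ?ST // !Tx ?ST.
have := cS z zSa; rewrite -subr_le0 -[X in X <= 0]mul1r (zE _ (ac 1)) !mul1r.
rewrite pc subrr add0r sub0r mulrN oppr_le0 pmulr_rge0 // subr_ge0 => cx.
have Sx : active_cell S x by move=> i /ST; apply: Tx.
rewrite FE; split=> //=; apply/eqP; rewrite eq_le cx andbT.
exact: cS.
Unshelve. all: by end_near. Qed.

Lemma active_cellI S T :
  active_cell S `&` active_cell T = active_cell (S :|: T).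
Proof.
apply/seteqP; split=> [x [Sx Tx] i|x STx].
  by rewrite inE => /orP[/Sx|/Tx].
by split=> i iS; apply: STx; rewrite inE iS ?orbT.
Qed.

Lemma active_complex_compatible : compatible f active_complex.
Proof.
split; last first.
  move=> P [->|[S /set0Pn[i iS] ->]].
    by exists (fun=> 0); split=> //; apply: affine_fun_cst.
  by exists (g i); split=> // x /(_ i iS).
split; last first.
  apply/seteqP; split=> // x _; have [_ [i fE]] := fmax x.
  exists (active_cell [set i]%SET).
    by right; exists [set i]%SET => //; apply/set0Pn; exists i; rewrite inE.
  by move=> j; rewrite inE => /eqP ->.
split.
- apply: (@sub_finite_set _ _ ([set set0] `|` (active_cell @` setT))).
    by move=> P [->|[S _ ->]]; [left | right; exists S].
  by rewrite finite_setU; split; [apply: finite_set1 | apply: finite_image].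
- move=> P [->|[S _ ->]]; first exact: set0_polyhedron.
  exact: active_cell_polyhedron.
- move=> P F [->|[S S0 ->]]; last exact: face_active_cell.
  by move=> [c [b [_ ->]]]; left; rewrite set0I.
move=> P Q [->|[S S0 ->]]; first by rewrite set0I; split; apply: face_set0.
move=> [->|[T T0 ->]]; first by rewrite setI0; split; apply: face_set0.
rewrite active_cellI; split; apply: active_cell_face => //.
  exact: finset.subsetUl.
exact: finset.subsetUr.
Qed.

Hypothesis ginj : injective g.
Hypothesis gfull : forall i, exists2 P, full_dimensional P & agree_on P f (g i).

Lemma active_complex_full_cells : (full_cells active_complex #= `I_k)%card.
Proof.
have fullS S i j : full_dimensional (active_cell S) -> i \in S -> j \in S -> i = j.
  move=> ST iS jS; apply: ginj; apply: agree_on_full_dimensional ST _ _ _ => //.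
  by move=> x Sx; rewrite !Sx.
have full1 i : full_dimensional (active_cell [set i]%SET).
  have [P PT fg] := gfull i; apply: full_dimensionalS PT => x Px j.
  by rewrite inE => /eqP ->; rewrite fg.
apply/card_eq_ordP; exists (fun i => active_cell [set i]%SET); split.
  move=> i j ij; apply: (fullS [set i; j]%SET); rewrite ?inE ?eqxx ?orbT //.
  by rewrite -active_cellI -ij setIid.
apply/seteqP; split=> [P [[->|[S /set0Pn[i iS] ->]] PT]|P [i _ <-]].
- have : affine_hull (set0 : set E) 0 by rewrite PT.
  move=> [[|n] [w [p [Pp w1 _]]]]; last by have := Pp ord0.
  by move: w1; rewrite big_ord0 => /esym/eqP; rewrite oner_eq0.
- exists i => //; congr active_cell; apply/setP => j; rewrite inE.
  by apply/eqP/idP => [->//|jS]; apply: fullS PT jS iS.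
split=> //; right; exists [set i]%SET => //.
by apply/set0Pn; exists i; rewrite inE.
Qed.

End CanonicalComplex.

(** * Components, pieces and the theorem *)

Section Components.
Variables (R : realType) (d : nat) (f : 'cV[R]_d -> R).

Lemma components_max (k : nat) (C : set (set 'cV[R]_d)) (g : 'I_k -> 'cV[R]_d -> R) :
  convex_function [set: 'cV[R]_d] f -> compatible f C ->
  [set h | affine_component f h] = range g ->
  forall x, is_max (g^~ x) (f x).
Proof.
move=> cf fC gE x; split=> [i|].
  apply: component_le => //; have : range g (g i) by exists i.
  by rewrite -gE.
have [P [CP PT Px]] := full_cells_cover x fC.1.
have [h [ah fh]] := fC.2 P CP.
have : [set h | affine_component f h] h by split=> //; exists C, P.
by rewrite gE => -[i _ gi]; exists i; rewrite gi fh.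
Qed.

(** Sending a full cell to its affine function is a map onto the components. *)
Lemma components_card_le (C : set (set 'cV[R]_d)) : compatible f C ->
  ([set h | affine_component f h] #<= full_cells C)%card.
Proof.
move=> fC; pose phi P := xget f [set h | affine_fun h /\ agree_on P f h].
apply: (@card_le_trans _ _ _ (phi @` full_cells C)); last exact: card_image_le.
apply: subset_card_le => h hc; have [P [CP PT fh]] := component_on_cell fC hc.
exists P => //; rewrite /phi; case: xgetP => [h' _ [ah' fh']|/(_ h) []]; last first.
  by split=> //; case: hc.
apply: agree_on_full_dimensional PT ah' hc.1 _ => x Px.
by rewrite -fh' // fh.
Qed.

Lemma has_components_pieces (k : nat) : convex_function [set: 'cV[R]_d] f ->
  cpwl f -> has_components f k -> has_pieces f k.
Proof.
move=> cf [_ [C fC]] fk; have /card_eq_ordP[g [ginj gE]] := fk.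
have gc i : affine_component f (g i).
  have : range g (g i) by exists i.
  by rewrite -gE.
have fmax := components_max cf fC gE.
have ag i : affine_fun (g i) := (gc i).1.
split; last first.
  move=> C' m fC' Cm; rewrite -card_le_II.
  by rewrite -(card_le_eql fk) -(card_le_eqr Cm) components_card_le.
exists (active_complex f g); split; first exact: active_complex_compatible.
apply: active_complex_full_cells => // i.
by have [_ [C' [P [_ _ PT fg]]]] := gc i; exists P.
Qed.

(** The components are finite in number because some compatible complex
    has finitely many full cells; their number is then a minimum of the same
    set of cell counts as [k]. *)
Lemma has_pieces_components (k : nat) : convex_function [set: 'cV[R]_d] f ->
  cpwl f -> has_pieces f k -> has_components f k.
Proof.
move=> cf fpl fk; have [[C [fC Ck]] kmin] := fk.
have /finite_setP[n fn] : finite_set [set h | affine_component f h].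
  apply: card_le_finite (components_card_le fC) _.
  by apply/finite_setP; exists k.
have [[C' [fC' C'n]] nmin] := has_components_pieces cf fpl fn.
suff -> : k = n by [].
by apply/eqP; rewrite eqn_leq (kmin _ _ fC' C'n) (nmin _ _ fC Ck).
Qed.

End Components.

Unset Implicit Arguments.

Theorem theorem8p3 (R : realType) (d : nat) (hd : (1 <= d)%N) :
  exists c : nat, forall f : 'cV[R]_d -> R,
    convex_function [set: 'cV[R]_d] f -> cpwl f ->
    forall k : nat,
      (has_components f k <-> has_pieces f k) /\
      (has_components f k ->
       forall r s : nat, (0 < r)%N -> (0 < s)%N -> (k <= r * s)%N ->
       exists N : relu_net R d (up_log 2 d.+1 + up_log 2 r),
         represents N f /\ (net_size N <= c * (r * s ^ d.+1))%N).
Proof.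
exists (6 * d.+2)%N => f cf fpl k; split.
  by split; [apply: has_components_pieces | apply: has_pieces_components].
move=> /card_eq_ordP[g [_ gE]] r s r0 s0 krs.
have /choice[a /choice[b ab]] : forall i, affine_fun (g i).
  move=> i; have : range g (g i) by exists i.
  by rewrite -gE => -[].
have [_ [C fC]] := fpl.
apply: (@max_affine_net _ _ k r s a b) => // x.
have -> : (fun i => dotv (a i) x + b i) = g^~ x by apply/funext => i; rewrite ab.
exact: components_max fC gE x.
Qed.
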